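(* Let $V$ be a finite set of players with coalition structure $\mathcal C=\{C_1,\dots,C_r\}$ (a partition of $V$), finite strategy sets $\mathcal S_{C_h}$, $\mathcal S=\prod_{h=1}^r\mathcal S_{C_h}$, and payoff functions $\Pi_{C_h}:\mathcal S\to\mathbb R$. Let $G=(\mathcal S,E)$ be a connected graph with $\mathcal C$-decomposition $(G_1,\dots,G_r)$, $G_h=(\mathcal S_{C_h},E_h)$, and consider the repeated $G$-game with $T=\infty$, minimal information $(I_m)$, and initial strategies of type $(P_0)$ or $(R_0)$. For any mixed $\mathcal C$-equilibrium $\Lambda_{C_1}\times\dots\times\Lambda_{C_r}\in\mathcal M_{\mathcal C}$, there exist $r$ independent Markov chains $X_{C_1}=(X_{C_1}(t):t\in\mathbb N),\dots,X_{C_r}=(X_{C_r}(t):t\in\mathbb N)$ with state spaces $\mathcal S_{C_1},\dots,\mathcal S_{C_r}$ and consistent with $G_1,\dots,G_r$, respectively, such that $X=(X_{C_1},\dots,X_{C_r})$ is a $\mathcal C$-equilibrium for the repeated $G$-game.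
   Context: Each player $j\in V$ has a finite set $\mathcal S_j$ of pure strategies; $\mathcal S_C=\prod_{j\in C}\mathcal S_j$ for a coalition $C\subset V$, and $\mathcal S=\prod_{j\in V}\mathcal S_j=\prod_h\mathcal S_{C_h}$. Graphs are finite, simple and undirected; two vertices are adjacent if they are equal or joined by an edge. $G$ has $\mathcal C$-decomposition $(G_1,\dots,G_r)$ if $G$ is the strong product of the $G_h$, i.e. $(s_{C_1},\dots,s_{C_r})$ and $(\bar s_{C_1},\dots,\bar s_{C_r})$ are adjacent in $G$ iff $s_{C_\ell},\bar s_{C_\ell}$ are adjacent in $G_\ell$ for every $\ell$. A stochastic process $(X(t):t\in\mathbb N)$ on the vertex set of a graph is consistent with the graph if, for each $t$, $X(t)$ and $X(t+1)$ are adjacent with probability one. Markov chains need not be homogeneous. Mixed $\mathcal C$-equilibrium: $\mathcal M_{\mathcal C}$ is the set of product distributions $\bar\Lambda=\prod_{h=1}^r\bar\Lambda_{C_h}$ on $\mathcal S$ ($\bar\Lambda_{C_h}$ a distribution on $\mathcal S_{C_h}$) such that, for every $\ell$ and every distribution $\Lambda_{C_\ell}$ on $\mathcal S_{C_\ell}$, $$\mathbb E_{\bar\Lambda_{C_1}\times\dots\times\bar\Lambda_{C_r}}(\Pi_{C_\ell})\ge\mathbb E_{\bar\Lambda_{C_1}\times\dots\times\bar\Lambda_{C_{\ell-1}}\times\Lambda_{C_\ell}\times\bar\Lambda_{C_{\ell+1}}\times\dots\times\bar\Lambda_{C_r}}(\Pi_{C_\ell}),$$ where $\mathbb E_\Lambda$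 is expectation under $\Lambda$. Repeated $G$-game with $T=\infty$: at each time $t\in\mathbb N$ each coalition $C_h$ plays a strategy $s_{C_h}(t)\in\mathcal S_{C_h}$, chosen on the basis of the available information, and $s_{C_h}(t+1)$ must be adjacent in $G_h$ to $s_{C_h}(t)$. Minimal information $(I_m)$: at time $t$ each coalition knows only $t$ and its own previously selected strategies, and nothing about the choices of the other coalitions (including their initial strategies). Initial strategies at time $0$ are either chosen by the players themselves (type $(P_0)$) or assigned by a referee (type $(R_0)$; the processes then start from the assigned strategies, whatever they are). $\mathcal C$-equilibrium for the repeated $G$-game ($T=\infty$, minimal information): a vector $X=(X_{C_1},\dots,X_{C_r})$ of independent stochastic processes, each adapted to the information of its coalition, with $X_{C_h}$ taking values in $\mathcal S_{C_h}$ and consistent with $G_h$, such that for each $\ell=1,\dots,r$ $$\mathbb E\left(\liminf_{t\to\infty}\frac1t\sum_{m=0}^{t-1}\Pi_{C_\ell}(X_{C_1}(m),\dots,X_{C_r}(m))\right)\ge$$ $$\ge\mathbb E\left(\liminf_{t\to\infty}\frac1t\sum_{m=0}^{t-1}\Pi_{C_\ell}(X_{C_1}(m),\dots,X_{C_{\ell-1}}(m),\tilde X_{C_\ell}(m),X_{C_{\ell+1}}(m),\dots,X_{C_r}(m))\right)$$ for any adapted stochastic process $\tilde X_{C_\ell}$ on $\mathcal S_{C_\ell}$ which is consistent with $G_\ell$ and independent from $X_{C_1},\dots,X_{C_{\ell-1}},X_{C_{\ell+1}},\dots,X_{C_r}$. *)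

(* Defs.v *)
From HB Require Import structures.
From mathcomp Require Import all_boot all_order all_algebra.
From mathcomp Require Import all_classical all_reals all_analysis.

Set Implicit Arguments.
Unset Strict Implicit.
Unset Printing Implicit Defensive.

Import Order.TTheory GRing.Theory Num.Theory.
Import numFieldNormedType.Exports.

Local Open Scope classical_set_scope.
Local Open Scope ring_scope.

Record simple_graph (T : finType) := SimpleGraph {
  edge : rel T;
  edge_sym : symmetric edge;
  edge_irr : irreflexive edge
}.

(* A vertex is adjacent to itself. *)
Definition adjacent (T : finType) (G : simple_graph T) (x y : T) : bool :=
  (x == y) || edge G x y.

Definition connected_graph (T : finType) (G : simple_graph T) : Prop :=
  forall x y : T, connect (edge G) x y.

Definition joint_strategy (V : finType) (S : V -> finType) (B : {set V})
    : finType :=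
  {dffun forall j : {j : V | j \in B}, S (val j)}.

(* From here on the coalitions are indexed by [I] and [A h] is the strategy
   set of coalition [h]; the strategy profiles of the whole game are taken in
   the form of the product of the [A h]. *)
Definition profile (I : finType) (A : I -> finType) : finType :=
  {dffun forall h : I, A h}.

Definition strong_decomposition (I : finType) (A : I -> finType)
    (G : simple_graph (profile A)) (Gs : forall h, simple_graph (A h)) : Prop :=
  forall s s' : profile A,
    adjacent G s s' <-> (forall h, adjacent (Gs h) (s h) (s' h)).

Definition is_distribution (R : realType) (T : finType) (mu : T -> R) : Prop :=
  (forall a, 0 <= mu a) /\ \sum_(a : T) mu a = 1.

Definition product_expectation (R : realType) (I : finType) (A : I -> finType)
    (L : forall h, A h -> R) (f : profile A -> R) : R :=
  \sum_(s : profile A) (\prod_(h : I) L h (s h)) * f s.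

(* [dfwith L l M] is the family [L] with its [l]-th member replaced by [M]. *)
Definition mixed_equilibrium (R : realType) (I : finType) (A : I -> finType)
    (Pi : I -> profile A -> R) (L : forall h, A h -> R) : Prop :=
  (forall h, is_distribution (L h)) /\
  (forall (l : I) (M : A l -> R), is_distribution M ->
     product_expectation L (Pi l) >=
     product_expectation (dfwith (T := fun h => A h -> R) L l M) (Pi l)).

Section Processes.
Context d (Omega : measurableType d) (R : realType) (P : probability Omega R).

Definition cond_prob (E F : set Omega) : R := fine (P (E `&` F)) / fine (P F).

Section OneProcess.
Context (T : finType) (X : nat -> Omega -> T).

Definition measurable_process : Prop :=
  forall t a, measurable (X t @^-1` [set a]).

Definition consistent_with (G : simple_graph T) : Prop :=
  forall t, P [set w | adjacent G (X t w) (X t.+1 w)] = 1%E.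

Definition past (t : nat) (x : nat -> T) : set Omega :=
  [set w | forall m, (m <= t)%N -> X m w = x m].

(* The transition probabilities may depend on [t]. *)
Definition markov_chain : Prop :=
  forall (t : nat) (x : nat -> T) (b : T), (0 < P (past t x))%E ->
    cond_prob (X t.+1 @^-1` [set b]) (past t x) =
    cond_prob (X t.+1 @^-1` [set b]) (X t @^-1` [set x t]).

Definition sigma_process : set (set Omega) :=
  <<s [set E | exists m a, E = X m @^-1` [set a]] >>.

(* Minimal information: all that a coalition observes is the time and its own
   strategies. A process is always adapted to its own filtration; that nothing
   is known about the other coalitions is the content of the independence
   requirements below. *)
Definition own_information (t : nat) : set (set Omega) :=
  <<s [set E | exists m a, (m <= t)%N /\ E = X m @^-1` [set a]] >>.

Definition adapted_minimal : Prop :=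
  forall t a, own_information t (X t @^-1` [set a]).

End OneProcess.

Section ManyProcesses.
Context (I : finType) (A : I -> finType) (X : forall h, nat -> Omega -> A h).

(* Subfamilies are covered by taking some [E h] equal to the whole space. *)
Definition independent_processes : Prop :=
  forall E : I -> set Omega, (forall h, sigma_process (X h) (E h)) ->
    P (\bigcap_h E h) = (\prod_(h : I) P (E h))%E.

Definition sigma_others (l : I) : set (set Omega) :=
  <<s [set E | exists h m (a : A h), h != l /\ E = X h m @^-1` [set a]] >>.

Definition independent_of_others (l : I) (Y : nat -> Omega -> A l) : Prop :=
  forall E F : set Omega, sigma_process Y E -> sigma_others l F ->
    P (E `&` F) = (P E * P F)%E.

Definition profile_at (m : nat) (w : Omega) : profile A :=
  [ffun h => X h m w].

Definition long_run_payoff (f : profile A -> R) : \bar R :=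
  ('E_P[(fun w =>
     limn_inf (fun t : nat =>
       t%:R^-1 * \sum_(m < t) f (profile_at m w)))%R])%E.

End ManyProcesses.
End Processes.

(* How the initial strategies arise: [Chosen] by the players, or [Assigned] by
   a referee. *)
Inductive initial (I : finType) (A : I -> finType) :=
  | Chosen
  | Assigned of profile A.
Arguments Chosen {I A}.
Arguments Assigned {I A}.

Section RepeatedGame.
Context (R : realType) (I : finType) (A : I -> finType).
Context (Gs : forall h, simple_graph (A h)) (Pi : I -> profile A -> R).
Context (init : initial A).

Definition initial_condition d (Omega : measurableType d)
    (P : probability Omega R) (l : I) (X : nat -> Omega -> A l) : Prop :=
  match init with
  | Chosen => True
  | Assigned s0 => P (X 0%N @^-1` [set s0 l]) = 1%E
  end.

Definition admissible d (Omega : measurableType d)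
    (P : probability Omega R) (l : I) (X : nat -> Omega -> A l) : Prop :=
  [/\ measurable_process X, adapted_minimal X, consistent_with P X (Gs l)
    & initial_condition P X].

(* A deviating coalition may randomize by means not available on [Omega]: the
   deviation [Y] lives on an arbitrary extension [phi : Omega' -> Omega] of the
   probability space, the other processes being composed with [phi]. Deviations
   on [Omega] itself are the case where [phi] is the identity. *)
Definition repeated_equilibrium d (Omega : measurableType d)
    (P : probability Omega R) (X : forall h, nat -> Omega -> A h) : Prop :=
  [/\ forall h, admissible P (X h),
      independent_processes P X
    & forall (l : I) d' (Omega' : measurableType d')
        (P' : probability Omega' R) (phi : Omega' -> Omega)
        (Y : nat -> Omega' -> A l),
        measurable_fun setT phi ->
        (forall E, measurable E -> P' (phi @^-1` E) = P E) ->
        admissible P' Y ->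
        let X' := fun h m w => X h m (phi w) in
        independent_of_others P' X' Y ->
        (long_run_payoff P X (Pi l) >=
         long_run_payoff P'
           (dfwith (T := fun h => nat -> Omega' -> A h) X' l Y) (Pi l))%E].

End RepeatedGame.

(* Main.v *)
(* Under minimal information nobody observes the others, so each coalition may
   draw a single target from its equilibrium distribution at the start, walk to
   it, and stay there for ever. Time averages then converge to the payoff of
   the targets, whose expectation is the equilibrium payoff. Against a deviator
   the others' targets are independent of whatever it plays at any given time,
   so its expected payoff at each late time is at most the equilibrium payoff,
   and Fatou's lemma carries this over to the expected lower limit.
   If the walk follows a spanning tree rooted at the assigned vertex, the
   present position determines the past, which makes it a Markov chain (in
   general inhomogeneous); a coalition choosing its initial strategy starts at
   the target. *)
Require Import Defs.
From HB Require Import structures.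
From mathcomp Require Import all_boot all_order all_algebra.
From mathcomp Require Import all_classical all_reals all_analysis.
From mathcomp Require Import measurable_realfun.

Set Implicit Arguments.
Unset Strict Implicit.
Unset Printing Implicit Defensive.

Import Order.TTheory GRing.Theory Num.Theory.
Import numFieldNormedType.Exports.

Local Open Scope classical_set_scope.
Local Open Scope ring_scope.

(** * Finite products, connected factors and spanning-tree walks *)

Lemma sum_dffun_prod (R : comNzRingType) (I : finType) (A : I -> finType)
    (F : forall h, A h -> R) :
  \sum_(s : {dffun forall h, A h}) \prod_h F h (s h) =
  \prod_h \sum_(a : A h) F h a.
Proof.
rewrite (reindex (@dffun_of_fprod I A)) /=; last exact/onW_bij/dffun_of_fprod_bij.
under eq_bigr => s _ do under eq_bigr => h _ do rewrite ffunE.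
transitivity (\sum_(s : fprod A) \prod_(h in I) [ffun a => F h a] (s h)).
  by apply: eq_bigr => s _; apply: eq_bigr => h _; rewrite ffunE.
rewrite (big_fprod 1 _ (fun h => [ffun a => F h a])).
rewrite -(bigA_distr_big_dep _ (fun h => untag 0 [ffun a => F h a])).
apply: eq_bigr => h _; rewrite big_tag.
apply: eq_bigr => j _; congr (untag _ _ _).
by apply/funext => a; rewrite ffunE.
Qed.

(** A path in [G] between two profiles that differ at most in coordinate [h] projects to a walk in
    [Gs h], some of whose steps may stand still. *)
Lemma connected_strong_factor (I : finType) (A : I -> finType)
    (G : simple_graph (profile A)) (Gs : forall h, simple_graph (A h))
    (s : profile A) :
  connected_graph G -> strong_decomposition G Gs ->
  forall h, connected_graph (Gs h).
Proof.
move=> Gc Gd h x y.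
pose u z : profile A := [ffun i => dfwith s h z i].
have uE z : u z h = z by rewrite ffunE dfwithin.
rewrite -(uE x) -(uE y).
have /connectP[p] := Gc (u x) (u y).
elim: p (u x) => [|t p IHp] v /=; first by move=> _ ->.
move=> /andP[vt pt] ty; apply: (connect_trans (y := t h)); last exact: IHp.
have /Gd/(_ h) : Defs.adjacent G v t by rewrite /Defs.adjacent vt orbT.
by rewrite /Defs.adjacent => /orP[/eqP ->|/connect1].
Qed.

(* In a breadth-first spanning tree rooted at [a], [w b t] is the vertex at
   depth [t] on the branch leading to [b], or [b] itself once it is reached.
   The current position determines all the previous ones. *)
Lemma spanning_tree_walk (T : finType) (G : simple_graph T) (a : T) :
  connected_graph G ->
  exists (w : T -> nat -> T) (N : nat),
    [/\ forall b, w b 0%N = a,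
        forall b t, Defs.adjacent G (w b t) (w b t.+1),
        forall b t, (N <= t)%N -> w b t = b
      & forall b t i, (i <= t)%N -> w (w b t) i = w b i].
Proof.
move=> Gc.
pose reach (x : T) : pred nat :=
  fun n => `[< exists p, [/\ path (edge G) a p, last a p = x & size p = n] >].
have ex x : exists n, reach x n.
  by have /connectP[p ap ->] := Gc a x; exists (size p); apply/asboolP; exists p.
pose d x := ex_minn (ex x).
have d_le x p : path (edge G) a p -> last a p = x -> (d x <= size p)%N.
  move=> ap px; rewrite /d; case: ex_minnP => m _; apply.
  by apply/asboolP; exists p.
have d_path x : exists p, [/\ path (edge G) a p, last a p = x & size p = d x].
  by rewrite /d; case: ex_minnP => m /asboolP.
have da : d a = 0%N by apply/eqP; rewrite -leqn0 (d_le a [::]).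
have d0 x : d x = 0%N -> x = a.
  by have [[|y p] [_ <- <-]] := d_path x.
(* The parent is the last vertex but one on a shortest path from [a]; the root is its own parent, in
   line with [0.-1 = 0]. *)
have parent x : exists y, d y = (d x).-1 /\ Defs.adjacent G y x.
  have [p [ap px sp]] := d_path x.
  case/lastP: p ap px sp => [|p z].
    by move=> _ /= <- _; exists a; rewrite da /Defs.adjacent eqxx.
  rewrite rcons_path last_rcons size_rcons => /andP[ap ez] zx sp.
  rewrite {}zx in ez.
  exists (last a p); split; last by rewrite /Defs.adjacent ez orbT.
  have le1 := d_le _ _ ap erefl.
  have [q [aq qp sq]] := d_path (last a p).
  have : (d x <= size (rcons q x))%N.
    by apply: d_le; rewrite ?last_rcons// rcons_path aq qp.
  rewrite size_rcons sq -sp /= ltnS => le2.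
  by apply/eqP; rewrite eqn_leq le1.
have [par parP] := choice parent.
have d_iter k x : d (iter k par x) = (d x - k)%N.
  elim: k => [|k IHk]; first by rewrite subn0.
  by rewrite iterS (parP _).1 IHk subnS.
(* The ancestor of [b] at depth [t] is [d b - t] steps up; truncated subtraction makes the walk rest
   at [b] after arrival. *)
exists (fun b t => iter (d b - t) par b), (\max_x d x); split => [b|b t|b t|b t i].
- by apply: d0; rewrite subn0 d_iter subnn.
- have [bt|tb] := leqP (d b) t.
    move: (bt) (leqW bt); rewrite -!subn_eq0 => /eqP -> /eqP -> /=.
    by rewrite /Defs.adjacent eqxx.
  by rewrite subnS -(subnSK tb) iterS /=; exact: (parP _).2.
- move=> Nt; have /eqP -> : (d b - t == 0)%N; last by [].
  by rewrite subn_eq0 (leq_trans _ Nt)//; exact: (leq_bigmax b).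
(* The vertex reached at time [t] has depth [minn t (d b)], so going up from it to depth [i] ends at
   the same ancestor. *)
- move=> it; rewrite d_iter -iterD; congr (iter _ _ _).
  have [bt|/ltnW tb] := leqP (d b) t.
    by move: bt; rewrite -subn_eq0 => /eqP ->; rewrite subn0 addn0.
  by rewrite subKn// addnC addnBA// subnK.
Qed.

(** * Expectations, Cesaro means and lower limits *)

Lemma expectation_finite_valued d (Omega : measurableType d) (R : realType)
    (P : probability Omega R) (T : finType) (W : Omega -> T) (q g : T -> R) :
  (forall s, measurable (W @^-1` [set s])) ->
  (forall s, P (W @^-1` [set s]) = (q s)%:E) ->
  ('E_P[g \o W] = (\sum_s q s * g s)%:E)%E.
Proof.
move=> mW PW; rewrite unlock.
transitivity (\int[P]_w (\sum_s (g s)%:E * (\1_(W @^-1` [set s]) w)%:E))%E.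
  apply: eq_integral => w _ /=.
  rewrite (bigD1 (W w))//= big1 ?adde0 => [|s sW].
    by rewrite indicE mem_set// mule1.
  rewrite indicE memNset ?mule0//= => Ws.
  by rewrite Ws eqxx in sW.
rewrite integral_sum//; last first.
  by move=> s; apply: integrableZl => //; exact: integrable_indic.
rewrite -sumEFin; apply: eq_bigr => s _.
rewrite integralZl//; last exact: integrable_indic.
by rewrite integral_indic// setIT [RHS]EFinM muleC; congr (_ * _)%E; exact: PW.
Qed.

Lemma cesaro_eventually_constant (R : realType) (u : nat -> R) (l : R) (N : nat) :
  (forall m, (N <= m)%N -> u m = l) ->
  (fun t : nat => t%:R^-1 * \sum_(m < t) u m) @ \oo --> l.
Proof.
move=> ul; have /cesaro : u @ \oo --> l.
  by apply: cvg_near_cst; exists N => // m /=; exact: ul.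
(* [cesaro] averages the first [t.+1] terms and the payoff average takes [t] of them, hence the
   shift. *)
rewrite -(@cvg_shiftS R^o (fun t : nat => t%:R^-1 * \sum_(m < t) u m)).
apply: cvg_trans; apply: near_eq_cvg; apply: nearW => t /=.
by rewrite /arithmetic_mean /series /= big_mkord.
Qed.

(** Boundedness keeps the tail infima finite, so the lower limit passes to the extended reals, the
    setting of Fatou's lemma. *)
Lemma limn_einf_EFin (R : realType) (u : nat -> R) : bounded_fun u ->
  limn_einf (EFin \o u) = (limn_inf u)%:E.
Proof.
move=> bu; rewrite limn_einf_lim.
have ubu := bounded_fun_has_ubound bu; have lbu := bounded_fun_has_lbound bu.
have -> : einfs (EFin \o u) = EFin \o infs u.
  apply/funext => n; rewrite /= /einfs /infs /= -ereal_inf_EFin.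
  - by congr ereal_inf; rewrite /sdrop image_comp.
  - exact: has_lbound_sdrop.
  - by exists (u n); exists n => /=.
apply: EFin_lim; apply/cvg_ex; eexists; exact: cvg_infs_sup.
Qed.

Lemma limn_inf_norm_le (R : realType) (u : nat -> R) (B : R) :
  (forall n, `|u n| <= B) -> `|limn_inf u| <= B.
Proof.
move=> uB.
have lbu : has_lbound (range u).
  by exists (- B) => _ [n _ <-]; have := uB n; rewrite ler_norml => /andP[].
have ubu : has_ubound (range u).
  by exists B => _ [n _ <-]; have := uB n; rewrite ler_norml => /andP[].
have cu : cvgn (infs u) by apply/cvg_ex; eexists; exact: cvg_infs_sup.
rewrite ler_norml; apply/andP; split.
  apply: limr_ge => //; apply: nearW => n; apply: lb_le_inf.
    by exists (u n); exists n => /=.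
  by move=> _ [m _ <-]; have := uB m; rewrite ler_norml => /andP[].
apply: limr_le => //; apply: nearW => n; apply: (@le_trans _ _ (u n)).
  by apply: ge_inf; [exact: has_lbound_sdrop|exists n => /=].
by have := uB n; rewrite ler_norml => /andP[].
Qed.

(** Fatou's lemma needs nonnegative functions, so it is applied to [B + a t], and [B] is
    cancelled. *)
Lemma expectation_limn_inf_le d (Omega : measurableType d) (R : realType)
    (P : probability Omega R) (a : nat -> Omega -> R) (B v : R) (b : nat -> R) :
  (forall t, measurable_fun setT (a t)) -> (forall t w, `|a t w| <= B) ->
  (forall t, 'E_P[a t] <= (b t)%:E)%E -> b @ \oo --> v ->
  ('E_P[fun w => limn_inf (a ^~ w)] <= v%:E)%E.
Proof.
move=> ma aB ab bv; set g : Omega -> R := fun w => _.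
have gE w : (g w)%:E = limn_einf (fun t => (a t w)%:E).
  rewrite -limn_einf_EFin//; exists B; split; first exact: num_real.
  by move=> M BM n _; exact: (le_trans (aB n w) (ltW BM)).
have gB w : `|g w| <= B by apply: limn_inf_norm_le => n.
have mg : measurable_fun setT g.
  apply/measurable_EFinP.
  (* The lower limit is minus the upper limit of the negatives, whose measurability is known. *)
  rewrite (_ : EFin \o g = fun w => - limn_esup (fun t => - (a t w)%:E))%E.
    apply: measurableT_comp => //; apply: measurable_fun_limn_esup => t.
    by apply: measurableT_comp => //; exact/measurable_EFinP.
  by apply/funext => w /=; rewrite gE.
have int_bounded (f : Omega -> R) : measurable_fun setT f -> (forall w, `|f w| <= B) ->
    P.-integrable setT (EFin \o f).
  move=> mf fB; apply: measurable_bounded_integrable => //.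
    apply: le_lt_trans (ltry 1); exact: probability_le1.
  exists B; split; first exact: num_real.
  by move=> M BM w _; exact: (le_trans (fB w) (ltW BM)).
have intB : P.-integrable setT (EFin \o cst B).
  by apply: finite_measure_integrable_cst.
have intD (f : Omega -> R) : measurable_fun setT f -> (forall w, `|f w| <= B) ->
    (\int[P]_w (B%:E + (f w)%:E) = B%:E + 'E_P[f])%E.
  move=> mf fB; rewrite unlock integralD//; last exact: int_bounded.
  by congr (_ + _)%E; have := expectation_cst P B; rewrite unlock.
rewrite -(leeD2lE (x := B%:E))// -intD//.
apply: (@le_trans _ _ (limn_einf (fun t => \int[P]_w (B%:E + (a t w)%:E)))%E).
  under eq_integral do rewrite gE -limn_einf_shift//.
  apply: fatou => // [t|t w _].
    by apply: emeasurable_funD => //; exact/measurable_EFinP.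
  rewrite -EFinD lee_fin -lerBlDl sub0r.
  by have := aB t w; rewrite ler_norml => /andP[].
rewrite limn_einf_lim -EFinD.
have cb : (fun t => (B + b t)%:E) @ \oo --> (B + v)%:E.
  by apply: cvg_EFin; [exact: nearW|apply: cvgD => //; exact: cvg_cst].
rewrite -(cvg_lim _ cb)//; apply: lee_lim.
- exact: is_cvg_einfs.
- by apply/cvg_ex; eexists; exact: cb.
(* The infimum over a tail is at most the integral at its first index, hence at most [B + b t]. *)
apply: nearW => t; rewrite EFinD.
apply: le_trans (leeD (lexx _) (ab t)).
by rewrite -intD//; apply: ereal_inf_lbound; exists t => /=.
Qed.

(** * A probability space carrying a given finite law *)

(** Point masses are put at the indices of [enum T]. On [nat] every set is measurable, so functions
    of [Z] raise no measurability question. *)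
Lemma finite_probability_space (R : realType) (T : finType) (p : T -> R) :
  is_distribution p ->
  exists (P : probability nat R) (Z : nat -> T), forall B : set T,
    P (Z @^-1` B) = (\sum_(t | t \in B) p t)%:E.
Proof.
move=> [p0 p1].
(* Total mass 1 forces [T] to be inhabited; [t0] is the default of [nth], taken at indices without
   mass. *)
have [t0 _] : exists t0 : T, t0 \in T.
  apply/existsP; apply: contraPT (oner_neq0 R); rewrite negb_exists => /forallP e.
  by apply/negP; rewrite negbK; apply/eqP; rewrite -p1 big1// => t _; have := e t; rewrite inE.
pose Z n := nth t0 (enum T) n.
pose m := msum (fun n => mscale (NngNum (p0 (Z n))) (\d_n : measure nat R)) #|T|.
have mE (B : set T) : m (Z @^-1` B) = (\sum_(t | t \in B) p t)%:E.
  transitivity (\sum_(t <- enum T) (if t \in B then (p t)%:E else 0))%E; last first.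
    by rewrite big_enum -big_mkcond sumEFin.
  rewrite (big_nth t0) -cardE big_mkord.
  apply: eq_bigr => i _; rewrite -[LHS]/((p (Z i))%:E * \d_(val i) (Z @^-1` B))%E diracE.
  rewrite (_ : (_ \in _ @^-1` _) = (Z i \in B)); last by apply/idP/idP; rewrite !inE.
  by rewrite /Z; case: ifP => _; rewrite ?mule1 ?mule0.
have m1 : (m setT = 1)%E.
  by rewrite -(preimage_setT Z) mE -p1; congr EFin; apply: eq_bigl => t; exact: mem_setT.
pose isP := Measure_isProbability.Build _ _ _ m m1.
pose P : probability nat R := HB.pack m isP.
by exists P, Z.
Qed.

(** * Laws of profiles and an upper bound on long-run payoffs *)

Section LawOfPayoffs.
Context d (Omega : measurableType d) (R : realType) (P : probability Omega R).

Lemma measurable_preimage_fin (T : finType) (W : Omega -> T) (B : set T) :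
  (forall s, measurable (W @^-1` [set s])) -> measurable (W @^-1` B).
Proof.
move=> mW; rewrite (_ : W @^-1` B = \bigcup_(s in B) W @^-1` [set s]).
  by apply: fin_bigcup_measurable => // s _; exact: mW.
apply/seteqP; split => [w Bw|w [s Bs Ws]]; first by exists (W w).
by rewrite /= Ws.
Qed.

Lemma measurable_fun_fin (T : finType) (W : Omega -> T) (g : T -> R) :
  (forall s, measurable (W @^-1` [set s])) -> measurable_fun setT (g \o W).
Proof.
move=> mW _ U _; rewrite setTI comp_preimage.
exact: measurable_preimage_fin.
Qed.

Variables (I : finType) (A : I -> finType).

Lemma preimage_profile_at (X : forall h, nat -> Omega -> A h) m (s : profile A) :
  profile_at X m @^-1` [set s] = \bigcap_h (X h m @^-1` [set s h]).
Proof.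
apply/seteqP; split => [w /= Ws h _|w Xs].
  by rewrite /= -Ws /profile_at ffunE.
by apply/ffunP => h; rewrite ffunE; exact: Xs.
Qed.

Lemma measurable_profile_at (X : forall h, nat -> Omega -> A h) m s :
  (forall h, measurable_process (X h)) ->
  measurable (profile_at X m @^-1` [set s]).
Proof.
move=> mX; rewrite preimage_profile_at.
by apply: fin_bigcap_measurable => // h _; exact: mX.
Qed.

Lemma law_finite_valued (T : finType) (W : Omega -> T) s :
  (forall s, measurable (W @^-1` [set s])) ->
  P (W @^-1` [set s]) = (fine (P (W @^-1` [set s])))%:E.
Proof. by move=> mW; rewrite fineK// fin_num_measure. Qed.

Lemma is_distribution_law (T : finType) (W : Omega -> T) :
  (forall s, measurable (W @^-1` [set s])) ->
  is_distribution (fun s => fine (P (W @^-1` [set s]))).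
Proof.
move=> mW; split=> [s|]; first exact/fine_ge0/measure_ge0.
have := expectation_finite_valued (cst 1) mW (fun s => law_finite_valued s mW).
rewrite (_ : cst 1 \o W = cst 1)// expectation_cst => -[->].
by apply: eq_bigr => s _; rewrite mulr1.
Qed.

(** The expected time average is the average of the expected payoffs, in which the finitely many
    times before [N] vanish in the limit; Fatou's lemma does the rest. *)
Lemma long_run_payoff_le (X : forall h, nat -> Omega -> A h)
    (f : profile A -> R) (v : R) (N : nat) :
  (forall h, measurable_process (X h)) ->
  (forall m, (N <= m)%N ->
     \sum_s fine (P (profile_at X m @^-1` [set s])) * f s <= v) ->
  (long_run_payoff P X f <= v%:E)%E.
Proof.
move=> mX ev.
have mW m s : measurable (profile_at X m @^-1` [set s]).
  exact: measurable_profile_at.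
pose e m := \sum_s fine (P (profile_at X m @^-1` [set s])) * f s.
have mf m : measurable_fun setT (f \o profile_at X m) by exact: measurable_fun_fin.
pose B := \sum_s `|f s|.
have fB s : `|f s| <= B by rewrite /B (bigD1 s)//= lerDl sumr_ge0.
have intf m : P.-integrable setT (EFin \o (f \o profile_at X m)).
  apply: measurable_bounded_integrable => //.
    by apply: le_lt_trans (ltry 1); exact: probability_le1.
  exists B; split; first exact: num_real.
  by move=> M BM w _; exact: (le_trans (fB _) (ltW BM)).
(* Taking the maximum of [e m] with [v] keeps an upper bound and gives a sequence equal to [v] from
   [N] on. *)
apply: (@expectation_limn_inf_le _ _ _ _ _ B v
  (fun t : nat => t%:R^-1 * \sum_(m < t) Num.max (e m) v)).
- move=> t; apply: measurable_funM => //.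
  by apply: measurable_sum => m; exact: mf.
- move=> t w; rewrite normrM ger0_norm ?invr_ge0//.
  (* At [t = 0] the average is 0, because the inverse of 0 is 0. *)
  have [->|t0] := posnP t; first by rewrite invr0 mul0r /B sumr_ge0.
  rewrite ler_pdivrMl ?ltr0n//; apply: le_trans (ler_norm_sum _ _ _) _.
  apply: le_trans (ler_sum _ (fun (m : 'I_t) _ => fB (profile_at X m w))) _.
  by rewrite sumr_const card_ord mulr_natl.
- move=> t; rewrite unlock.
  rewrite (_ : (\int[P]_w _)%E = (t%:R^-1 * \sum_(m < t) e m)%:E).
    by rewrite lee_fin ler_wpM2l ?invr_ge0// ler_sum// => m _; rewrite le_max lexx.
  under eq_integral do rewrite EFinM -sumEFin.
  rewrite integralZl//; last first.
    by apply: integrable_sum => // m _; exact: intf.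
  rewrite integral_sum//; last by move=> m; exact: intf.
  rewrite EFinM -sumEFin; congr (_ * _)%E; apply: eq_bigr => m _.
  have := expectation_finite_valued f (mW m) (fun s => law_finite_valued s (mW m)).
  by rewrite unlock.
- apply: (@cesaro_eventually_constant _ (fun m => Num.max (e m) v) _ N) => m Nm.
  by apply/max_idPr; exact: ev.
Qed.

End LawOfPayoffs.

(** * Processes frozen from time [N] on with the equilibrium laws *)

Section Equilibrium.
Context d (Omega : measurableType d) (R : realType) (P : probability Omega R).
Variables (I : finType) (A : I -> finType).
Variables (Gs : forall h, simple_graph (A h)) (Pi : I -> profile A -> R).
Variables (init : initial A) (L : forall h, A h -> R).
Variables (X : forall h, nat -> Omega -> A h) (N : nat).
Hypothesis L_eq : mixed_equilibrium Pi L.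
Hypothesis X_adm : forall h, admissible Gs init P (X h).
Hypothesis X_indep : independent_processes P X.
Hypothesis X_const : forall h t w, (N <= t)%N -> X h t w = X h N w.
Hypothesis X_law : forall h a, P (X h N @^-1` [set a]) = (L a)%:E.

Let X_meas h : measurable_process (X h). Proof. by case: (X_adm h). Qed.

Let X_lawt h t a : (N <= t)%N -> P (X h t @^-1` [set a]) = (L a)%:E.
Proof.
move=> Nt; rewrite -X_law; congr (P _).
by apply/seteqP; split => w /=; rewrite X_const.
Qed.

Lemma payoff_eventually_constant l :
  long_run_payoff P X (Pi l) = (product_expectation L (Pi l))%:E.
Proof.
rewrite /long_run_payoff.
rewrite (_ : (fun w => limn_inf _) = Pi l \o profile_at X N); last first.
  apply/funext => w /=; apply: (cvg_limn_inf_sup _).1.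
  apply: (@cesaro_eventually_constant _ (fun m => Pi l (profile_at X m w)) _ N).
  move=> m Nm; congr (Pi l _); apply/ffunP => h; rewrite !ffunE.
  exact: X_const.
apply: expectation_finite_valued => s; first exact: measurable_profile_at.
rewrite preimage_profile_at X_indep => [|h]; last first.
  by apply: sub_sigma_algebra; exists N, (s h).
by rewrite -prodEFin; apply: eq_bigr => h _; exact: X_law.
Qed.

Section Deviation.
Context d' (Omega' : measurableType d') (P' : probability Omega' R).
Variables (phi : Omega' -> Omega) (l : I) (Y : nat -> Omega' -> A l).
Hypothesis mphi : measurable_fun setT phi.
Hypothesis P'phi : forall E, measurable E -> P' (phi @^-1` E) = P E.
Hypothesis Y_meas : measurable_process Y.
Let X' := fun h m w => X h m (phi w).
Hypothesis Y_indep : independent_of_others P' X' Y.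

Let XY := dfwith (T := fun h => nat -> Omega' -> A h) X' l Y.

Let X'_meas h m a : measurable (X' h m @^-1` [set a]).
Proof. by have := @mphi measurableT _ (@X_meas h m a); rewrite setTI. Qed.

Let XY_meas h : measurable_process (XY h).
Proof.
rewrite /XY; have [<-|lh] := eqVneq l h; first by rewrite dfwithin.
by rewrite dfwithout// => t a; exact: X'_meas.
Qed.

(* The deviation is independent of the others at each single time, so that
   from time [N] on it only amounts to a one-shot deviation from [L]. *)
Lemma law_deviation m s : (N <= m)%N ->
  P' (profile_at XY m @^-1` [set s]) =
  (\prod_h dfwith (T := fun h => A h -> R) L l
     (fun a => fine (P' (Y m @^-1` [set a]))) h (s h))%:E.
Proof.
(* [F] concerns the others alone and lives on [Omega]: independence from [Y] is used on [Omega'],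
   then mutual independence on [Omega]. *)
move=> Nm; pose F := \bigcap_(h in [set h | h != l]) (X h m @^-1` [set s h]).
have mF : measurable F.
  by apply: fin_bigcap_measurable => [|h _]; [exact: finite_finset|exact: X_meas].
have -> : profile_at XY m @^-1` [set s] =
    (Y m @^-1` [set s l]) `&` (phi @^-1` F).
  rewrite preimage_profile_at; apply/seteqP; split => w.
    move=> Ws; split; first by have := Ws l Logic.I; rewrite /XY dfwithin.
    by move=> h hl; have := Ws h Logic.I; rewrite /XY dfwithout// eq_sym.
  move=> [Yw Fw] h _; rewrite /XY; have [<-|lh] := eqVneq l h.
    by rewrite dfwithin.
  by rewrite dfwithout//; apply: Fw; rewrite /= eq_sym.
rewrite Y_indep; first last.
- rewrite (_ : phi @^-1` F =
      \bigcap_(h in [set h | h != l]) (X' h m @^-1` [set s h])); last first.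
    by rewrite /F preimage_bigcap.
  apply: (@fin_bigcap_measurable _ (g_sigma_algebraType _)) => [|h hl].
    exact: finite_finset.
  by apply: sub_sigma_algebra; exists h, m, (s h).
- by apply: sub_sigma_algebra; exists m, (s l).
rewrite P'phi// (bigD1 l)//= dfwithin EFinM.
congr (_ * _)%E; first exact: law_finite_valued.
(* The whole space in place [l] makes the independence of all processes apply to those other than
   [l]. *)
pose E h := if h == l then setT else X h m @^-1` [set s h].
have -> : F = \bigcap_h E h.
  apply/seteqP; split => w Fw h; rewrite /E.
    by move=> _; case: eqVneq => // hl; exact: Fw.
  by move=> hl; have := Fw h Logic.I; rewrite /E (negbTE hl).
rewrite X_indep => [|h]; last first.
  rewrite /E; case: ifP => _; last by apply: sub_sigma_algebra; exists m, (s h).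
  exact: (@measurableT _ (g_sigma_algebraType _)).
rewrite (bigD1 l)//= {1}/E eqxx probability_setT mul1e -prodEFin.
apply: eq_bigr => h hl; rewrite /E (negbTE hl) dfwithout 1?eq_sym//.
exact: X_lawt.
Qed.

(** The law of [Y m] may vary with [m], but at each time from [N] on it is a one-shot deviation that
    [L_eq] shows to be unprofitable. *)
Lemma payoff_deviation_le :
  (long_run_payoff P' XY (Pi l) <= (product_expectation L (Pi l))%:E)%E.
Proof.
apply: (long_run_payoff_le (N := N)) => // m Nm.
have /(L_eq.2 l) := is_distribution_law P' (Y_meas m).
apply: le_trans; rewrite le_eqVlt; apply/orP; left; apply/eqP.
by apply: eq_bigr => s _; rewrite law_deviation.
Qed.

End Deviation.

Lemma eventually_constant_equilibrium : repeated_equilibrium Gs Pi init P X.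
Proof.
split=> // l d' Omega' P' phi Y mphi P'phi [mY _ _ _] X' Y_indep.
by rewrite payoff_eventually_constant; exact: payoff_deviation_le.
Qed.

End Equilibrium.

(** * Walks to independent random targets *)

Section TargetedWalks.
Context d (Omega : measurableType d) (R : realType) (P : probability Omega R).
Variables (I : finType) (A : I -> finType) (L : forall h, A h -> R).
Arguments L : clear implicits.
Variable Z : Omega -> profile A.
Hypothesis L1 : forall h, \sum_a L h a = 1.
Hypothesis Z_meas : forall B : set (profile A), measurable (Z @^-1` B).
Hypothesis Z_law : forall B : set (profile A),
  P (Z @^-1` B) = (\sum_(s | s \in B) \prod_h L h (s h))%:E.

(** Cutting each [L h] down to [B h] turns the sum over a rectangle into a product of sums; this is
    the source of all independence below. *)
Lemma rectangle_law (B : forall h, set (A h)) :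
  P (\bigcap_h ((fun o => Z o h) @^-1` B h)) =
  (\prod_h \sum_(a | a \in B h) L h a)%:E.
Proof.
rewrite (_ : \bigcap_h _ = Z @^-1` [set s | forall h, B h (s h)]); last first.
  by apply/seteqP; split => w Bw h; [exact: Bw|move=> _; exact: Bw].
rewrite Z_law; congr EFin.
under [RHS]eq_bigr do rewrite big_mkcond.
rewrite -(sum_dffun_prod (fun h a => if a \in B h then L h a else 0)).
rewrite big_mkcond; apply: eq_bigr => s _.
case: ifPn => [/[!inE] Bs|].
  by apply: eq_bigr => h _; rewrite ifT//; exact/mem_set/Bs.
rewrite notin_setE => /existsNP[h Bh].
by rewrite (bigD1 h)//= ifF ?mul0r//; apply/negbTE; rewrite notin_setE.
Qed.

Lemma marginal_law h (B : set (A h)) :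
  P ((fun o => Z o h) @^-1` B) = (\sum_(a | a \in B) L h a)%:E.
Proof.
pose C := dfwith (T := fun i => set (A i)) (fun=> setT) h B.
have -> : (fun o => Z o h) @^-1` B = \bigcap_i ((fun o => Z o i) @^-1` C i).
  apply/seteqP; split => w Cw; last by have := Cw h Logic.I; rewrite /C dfwithin.
  move=> i _; rewrite /C; have [<-|hi] := eqVneq h i; first by rewrite dfwithin.
  by rewrite dfwithout.
rewrite rectangle_law (bigD1 h)//= {1}/C dfwithin [X in _ * X]big1 ?mulr1// => i ih.
rewrite /C dfwithout 1?eq_sym// -(L1 i).
by apply: eq_bigl => a; exact: mem_setT.
Qed.

Variables (w : forall h, A h -> nat -> A h) (N : nat).
Arguments w : clear implicits.
Hypothesis w_end : forall h b t, (N <= t)%N -> w h b t = b.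
Hypothesis w_mem : forall h b t i, (i <= t)%N -> w h (w h b t) i = w h b i.

Definition targeted_walk h t (o : Omega) : A h := w h (Z o h) t.

(** Events depending on the target alone form a sigma-algebra containing the generators.
    Independence of the walks thus reduces to that of the targets. *)
Lemma sigma_targeted_walk h E : sigma_process (targeted_walk h) E ->
  exists B : set (A h), E = (fun o => Z o h) @^-1` B.
Proof.
move: E; apply: smallest_sub; last first.
  by move=> _ [m [a ->]]; exists [set b | w h b m = a].
split; first by exists set0; rewrite preimage_set0.
  by move=> _ [B ->]; exists (~` B); rewrite setTD preimage_setC.
move=> F /choice[B FB]; exists (\bigcup_k B k); rewrite preimage_bigcup.
by apply: eq_bigcup => // k _; exact: FB.
Qed.

Lemma independent_targeted_walks : independent_processes P targeted_walk.
Proof.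
move=> E Esig; have EB h := sigma_targeted_walk (Esig h).
pose B h := sval (cid (EB h)).
have EE h : E h = (fun o => Z o h) @^-1` B h by rewrite /B; case: cid.
under eq_bigcapr do rewrite EE.
rewrite rectangle_law -prodEFin; apply: eq_bigr => h _.
by rewrite EE marginal_law.
Qed.

(** By [w_mem] the present position fixes all earlier ones, so the two conditioning events
    coincide. *)
Lemma markov_targeted_walk h : markov_chain P (targeted_walk h).
Proof.
move=> t x b past0; congr (cond_prob P _ _).
(* Positive probability yields an outcome [u] realizing [x]; for an unrealizable [x] the two events
   could differ. *)
have [u xu] : past (targeted_walk h) t x !=set0.
  by apply/set0P; apply: contraTneq past0 => ->; rewrite measure0 ltxx.
apply/seteqP; split => v xv; first exact: xv.
move=> m mt; rewrite -(xu m mt) /targeted_walk -(w_mem _ mt) -[RHS](w_mem _ mt).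
by congr (w _ _ _); rewrite -[LHS]/(targeted_walk h t v) xv -(xu t).
Qed.

Lemma measurable_targeted_walk h : measurable_process (targeted_walk h).
Proof.
move=> t a; rewrite (_ : _ @^-1` _ = Z @^-1` [set s | w h (s h) t = a])//.
Qed.

Lemma law_targeted_walk h a : P (targeted_walk h N @^-1` [set a]) = (L h a)%:E.
Proof.
rewrite (_ : _ @^-1` _ = (fun o => Z o h) @^-1` [set a]).
  rewrite marginal_law (big_pred1 a)// => b.
  by apply/idP/eqP; rewrite inE.
by apply/seteqP; split => o /=; rewrite /targeted_walk w_end.
Qed.

Variable Gs : forall h, simple_graph (A h).
Hypothesis w_adj : forall h b t, Defs.adjacent (Gs h) (w h b t) (w h b t.+1).

Lemma consistent_targeted_walk h : consistent_with P (targeted_walk h) (Gs h).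
Proof.
move=> t; rewrite (_ : [set _ | _] = setT); first exact: probability_setT.
by apply/seteqP; split => // o _; exact: w_adj.
Qed.

Lemma targeted_walk_equilibrium (Pi : I -> profile A -> R) (init : initial A) :
  mixed_equilibrium Pi L ->
  (forall h, initial_condition init P (targeted_walk h)) ->
  [/\ forall h, markov_chain P (targeted_walk h),
      forall h, consistent_with P (targeted_walk h) (Gs h),
      independent_processes P targeted_walk
    & repeated_equilibrium Gs Pi init P targeted_walk].
Proof.
move=> Leq init0; split.
- exact: markov_targeted_walk.
- exact: consistent_targeted_walk.
- exact: independent_targeted_walks.
apply: (@eventually_constant_equilibrium _ _ _ _ _ _ _ _ _ L _ N) => //.
- move=> h; split=> //.
  + exact: measurable_targeted_walk.
  + by move=> t a; apply: sub_sigma_algebra; exists t, a.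
  + exact: consistent_targeted_walk.
- exact: independent_targeted_walks.
- by move=> h t o Nt; rewrite /targeted_walk !w_end.
- exact: law_targeted_walk.
Qed.

End TargetedWalks.

(** * The two types of initial strategies *)

Theorem corollary1 (R : realType) (V : finType) (S : V -> finType)
  (r : nat) (C : 'I_r -> {set V})
  (C_inj : injective C)
  (C_partition : finset.partition [set C h | h : 'I_r]%SET [set: V]%SET)
  (Pi : 'I_r -> profile (fun h => joint_strategy S (C h)) -> R)
  (G : simple_graph (profile (fun h => joint_strategy S (C h))))
  (Gs : forall h : 'I_r, simple_graph (joint_strategy S (C h)))
  (G_connected : connected_graph G)
  (G_decomposition : strong_decomposition G Gs)
  (Lambda : forall h : 'I_r, joint_strategy S (C h) -> R)
  (Lambda_equilibrium : mixed_equilibrium Pi Lambda) :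
  (* initial strategies chosen by the players *)
  (exists (d : measure_display) (Omega : measurableType d)
     (P : probability Omega R)
     (X : forall h : 'I_r, nat -> Omega -> joint_strategy S (C h)),
     [/\ forall h, markov_chain P (X h),
         forall h, consistent_with P (X h) (Gs h),
         independent_processes P X
       & repeated_equilibrium Gs Pi Chosen P X]) /\
  (* initial strategies assigned by a referee: [X h a] is the chain played by
     coalition [h] when assigned [a], irrespective of what the others are
     assigned *)
  (exists (d : measure_display) (Omega : measurableType d)
     (P : probability Omega R)
     (X : forall h : 'I_r,
        joint_strategy S (C h) -> nat -> Omega -> joint_strategy S (C h)),
     forall s0 : profile (fun h => joint_strategy S (C h)),
     let X0 := fun h : 'I_r => X h (s0 h) in
     [/\ forall h, markov_chain P (X0 h),
         forall h, consistent_with P (X0 h) (Gs h),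
         independent_processes P X0
       & repeated_equilibrium Gs Pi (Assigned s0) P X0]).
Proof.
have [L_dist _] := Lambda_equilibrium.
have L1 h : \sum_a Lambda h a = 1 by case: (L_dist h).
have prod_dist : is_distribution
    (fun s : profile (fun h => joint_strategy S (C h)) => \prod_h Lambda h (s h)).
  split=> [s|]; first by apply: prodr_ge0 => h _; exact: (L_dist h).1.
  by rewrite sum_dffun_prod big1.
have [P [Z Z_law]] := finite_probability_space prod_dist.
have Z_meas (B : set (profile (fun h => joint_strategy S (C h)))) :
  measurable (Z @^-1` B) by [].
split.
  (* Each walk sits at its target from time 0. *)
  exists _, nat, P, (targeted_walk Z (fun h b _ => b)).
  apply: (@targeted_walk_equilibrium _ _ _ P _ _ Lambda Z L1 Z_meas Z_law
    (fun h b _ => b) 0) => // h b t.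
  by rewrite /Defs.adjacent eqxx.
(* [Z 0%N] is an arbitrary profile that fills in the other coordinates. *)
have Gs_connected := connected_strong_factor (Z 0%N) G_connected G_decomposition.
(* There is one tree for each possible root [a], so the chain of coalition [h] depends on its own
   assignment alone. *)
have walks h a := cid (spanning_tree_walk a (@Gs_connected h)).
pose w h a := sval (walks h a).
have ends h a := cid (svalP (walks h a)).
have wP h a := svalP (ends h a).
exists _, nat, P, (fun h a t o => w h a (Z o h) t) => s0.
(* By the maximum of the arrival bounds every coalition has reached its target. *)
apply: (@targeted_walk_equilibrium _ _ _ P _ _ Lambda Z L1 Z_meas Z_law
  (fun h => w h (s0 h)) (\max_h sval (ends h (s0 h)))) => //.
- move=> h b t Nt; have [_ _ w_end _] := wP h (s0 h).
  by apply: w_end; apply: leq_trans Nt; exact: (leq_bigmax h).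
- by move=> h b t i; have [_ _ _] := wP h (s0 h); exact.
- by move=> h b t; have [_ w_adj _ _] := wP h (s0 h); exact: w_adj.
- move=> h; rewrite /initial_condition.
  rewrite (_ : _ @^-1` _ = setT); first exact: probability_setT.
  by apply/seteqP; split => // o _; have [w0 _ _ _] := wP h (s0 h); exact: w0.
Qed.
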